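(* Let $\rho$ be any non-trivial finite partition of $[0,1]$ and let $\omega=\{[0,1]\}$ be the trivial partition. Then the sequence of partitions $\{\rho^n\omega\}_{n\ge 1}$, obtained by successive $\rho$-refinements of $\omega$, is uniformly distributed.
   Context: A finite partition of $[0,1]$ is a family of intervals $\pi=\{[t_{i-1},t_i] : 1\le i\le k\}$ with $0=t_0<t_1<\dots<t_k=1$; it is non-trivial if $k\ge 2$. Given a non-trivial finite partition $\rho=\{[r_{i-1},r_i]:1\le i\le k\}$ of $[0,1]$, the $\rho$-refinement $\rho\pi$ of a partition $\pi$ is obtained by subdividing all the intervals of $\pi$ having maximal length (and only those) positively homothetically to $\rho$: each interval $[a,b]\in\pi$ of maximal length is replaced by the $k$ intervals $[a+(b-a)r_{i-1},\,a+(b-a)r_i]$, $1\le i\le k$, and the other intervals of $\pi$ are left unchanged. Iterating, $\rho^1\pi=\rho\pi$ and $\rho^{n}\pi=\rho(\rho^{n-1}\pi)$ for $n\ge 2$. A sequence of partitions $\{\pi_n\}$ of $[0,1]$, $\pi_n=\{[t_{i-1}^n,t_i^n]:1\le i\le k(n)\}$, is uniformly distributed if for every continuous function $f$ on $[0,1]$ $$\lim_{n\to\infty}\frac{1}{k(n)}\sum_{i=1}^{k(n)}f(t_i^n)=\int_0^1 f(t)\,dt.$$ *)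

(* Defs.v *)
From HB Require Import structures.
From mathcomp Require Import all_boot all_order all_algebra.
From mathcomp Require Import all_classical all_reals all_analysis.

Set Implicit Arguments.
Unset Strict Implicit.
Unset Printing Implicit Defensive.

Import Order.TTheory GRing.Theory Num.Theory.
Import numFieldNormedType.Exports.

Local Open Scope classical_set_scope.
Local Open Scope ring_scope.

(* A finite partition 0 = t_0 < t_1 < ... < t_k = 1 of [0, 1] is given by the
   sequence [:: t_1; ...; t_k] of the right endpoints of its k intervals
   [t_(i-1), t_i]; the point t_0 = 0 is implicit. *)
Record partition01 (R : realType) := Partition01 {
  points :> seq R ;
  pointsP : itv_partition 0 1 points }.

Section Partitions.
Variable R : realType.
Implicit Types pi rho : partition01 R.

Definition nb_intervals pi : nat := size pi.

Definition nontrivial pi : bool := (2 <= nb_intervals pi)%N.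

Definition trivial_partition : partition01 R :=
  Partition01 (itv_partition1 (@ltr01 R)).

(* All lengths are positive, so the default value 0 does not affect the
   maximum. *)
Definition mesh pi : R :=
  \big[Num.max/0]_(l <- pairmap (fun a b => b - a) 0 pi) l.

(* Right endpoints of the images of the intervals of rho under the increasing
   affine map from [0, 1] onto [a, b]. *)
Definition subdivide rho (a b : R) : seq R :=
  [seq a + (b - a) * r | r <- rho].

(* pairmap visits the intervals [a, b] of pi from left to right. *)
Definition refine_points rho pi : seq R :=
  flatten (pairmap
    (fun a b => if b - a == mesh pi then subdivide rho a b else [:: b]) 0 pi).

Lemma subdivideP rho a b : a < b -> itv_partition a b (subdivide rho a b).
Proof.
move=> ab; have ba0 : 0 < b - a by rewrite subr_gt0.
pose h r := a + (b - a) * r.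
have hh : {mono h : x y / x < y} by move=> x y; rewrite ltrD2l ltr_pM2l.
have h0 : h 0 = a by rewrite /h mulr0 addr0.
have h1 : h 1 = b by rewrite /h mulr1 addrC subrK.
have [rho_path /eqP rho_last] := pointsP rho.
rewrite /subdivide -/h -[X in itv_partition X _ _]h0; split.
  rewrite path_map; apply: sub_path rho_path => x y xy.
  by change (h x < h y); rewrite hh.
by rewrite last_map rho_last h1.
Qed.

Lemma refine_pointsP rho pi : itv_partition 0 1 (refine_points rho pi).
Proof.
rewrite /refine_points; move: (mesh pi) => m.
case: pi => s /=; move: (0 : R) => a.
elim: s a => [//|b s IH] a abs /=.
have ab : a < b by case: abs => /= /andP[].
apply: (itv_partition_cat (b := b)); last exact: IH (itv_partition_cons abs).
by case: ifP => _; [exact: subdivideP | exact: itv_partition1].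
Qed.

Definition refine rho pi : partition01 R :=
  Partition01 (refine_pointsP rho pi).

Definition uniformly_distributed (pi_ : nat -> partition01 R) : Prop :=
  forall f : R -> R, {within `[0, 1], continuous f} ->
    (nb_intervals (pi_ n))%:R^-1 * \sum_(t <- pi_ n) f t @[n --> \oo]
      --> \int[lebesgue_measure]_(t in `[0, 1]) f t.

End Partitions.

Arguments trivial_partition {R}.

(* Main.v *)
Require Import Defs.
From mathcomp Require Import all_boot all_order all_algebra.
From mathcomp Require Import all_classical all_reals all_analysis.
From mathcomp Require Import ring lra.
Set Implicit Arguments.
Unset Strict Implicit.
Unset Printing Implicit Defensive.
Import Order.TTheory GRing.Theory Num.Theory.
Import numFieldNormedType.Exports.
Local Open Scope classical_set_scope.
Local Open Scope ring_scope.

(** Write [split_to s] for the partition obtained from [0, 1] by applying rho,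
    again and again, to every interval of length at least [s], and [N s] for
    its number of intervals.

    The successive rho-refinements are partitions of this kind. If pi is
    [split_to s] and m is its longest length, then m < s and the intervals that
    have to be cut to pass from pi to [split_to m] are those of length m
    ([refine_split_to]). Moreover [s * N s] is bounded for [s <= 1], as all intervals of
    [split_to s] have length at least a constant times [s]; since each
    refinement creates new intervals, the meshes tend to 0
    ([mesh_iter_refine_cvg]). It remains to see that [split_to s] becomes
    equidistributed as [s] tends to 0 from the right.

    An interval J of a coarse partition [split_to r] contains [N (s / |J|)] of
    the [N s] intervals of [split_to s], by self-similarity. So it has the right
    share of them in the limit iff [N (s / |J|) / N s] tends to |J|, which for
    [M s := s * N s] means that [M s - M (s / |J|)] tends to 0. As |J| is a
    product of lengths of rho, it is enough that [M s - M (s / x)] tends to 0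
    for each length x of rho.

    Cutting [0, 1] once gives [N s = \sum_x N (s / x)] for [s <= 1], that is,
    [M s = \sum_x x * M (s / x)]: a bounded function is at each point an average
    of its values at the points [s / x]. The increment
    [D s := M s - M (s / x)] satisfies the same equation. Let b be its upper
    limit at 0 and suppose b > 0. Where [D] is nearly b, the terms of the average
    are nearly b too, in particular [D (s / x)]; hence [D] is nearly b along a
    long chain [s, s / x, s / x ^+ 2] and so on, and the sum of these increments
    makes [M] unbounded. So b <= 0, and the same for [- M] concludes
    ([self_averaging_diff_cvg]). This replaces the renewal theorem, and works
    whether or not the logarithms of the lengths are commensurable.

    Finally, a continuous f is nearly constant on each J, so the average of f
    over the points of [split_to s] is close to the sum over J of f times the
    share of J, hence to a Riemann sum of f, hence to its integral
    ([split_to_equidistributed]). *)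

(** * Functions that average their values at larger scales *)

Section Renewal.
Variables (R : realType) (w : seq R) (p : R).
Hypotheses (p0 : 0 < p) (wp : {in w, forall x, p <= x <= 1 - p}).
Hypothesis w1 : \sum_(x <- w) x = 1.

Definition self_averaging (M : R -> R) (c : R) : Prop :=
  forall s, 0 < s <= c -> M s = \sum_(x <- w) x * M (s / x).

Lemma weight_gt0 x : x \in w -> 0 < x.
Proof. by move=> /wp /andP[px _]; exact: lt_le_trans px. Qed.

Lemma weight_lt1 x : x \in w -> x < 1.
Proof. by move=> /wp /andP[_ xp]; have := p0; lra. Qed.

Lemma div_weight_gt0 s x : 0 < s -> x \in w -> 0 < s / x.
Proof. by move=> s0 /weight_gt0 x0; rewrite divr_gt0. Qed.

Lemma div_weight_le s x c : 0 < s -> s <= p * c -> x \in w -> s / x <= c.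
Proof.
move=> s0 sc xw; rewrite ler_pdivrMr ?weight_gt0//.
have /andP[px _] := wp xw.
have c0 : 0 <= c by rewrite -(pmulr_rge0 _ p0) ltW// (lt_le_trans s0).
by apply: le_trans sc _; rewrite mulrC ler_wpM2l.
Qed.

Lemma self_averaging_diff M x : x \in w -> self_averaging M 1 ->
  self_averaging (fun s => M s - M (s / x)) p.
Proof.
move=> xw Mh s /andP[s0 sp].
have x1 := weight_lt1 xw; have x0 := weight_gt0 xw.
have sx1 : s / x <= 1 by apply: div_weight_le; rewrite ?mulr1.
have s1 : s <= 1 by apply: le_trans sx1; rewrite ler_pdivlMr//; nra.
rewrite Mh ?s0// (Mh (s / x)) ?div_weight_gt0//.
rewrite -sumrB; apply: eq_bigr => y _; rewrite mulrBr.
by congr (_ - y * M _); rewrite mulrAC.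
Qed.

(** Maximum principle: [D (u / x)] has weight [x] in the average [D u], so it
    cannot be much below the upper bound of the terms if [D u] is close to it. *)
Lemma self_averaging_near_max D c b e x u : x \in w -> self_averaging D c ->
  0 < u <= c -> 0 < e ->
  b - x * e / 2 <= D u ->
  {in w, forall y, D (u / y) <= b + x * e / 2} ->
  b - e <= D (u / x).
Proof.
move=> xw Dh uc e0 Du Dle.
have x0 := weight_gt0 xw; have x1 := weight_lt1 xw.
have : \sum_(y <- rem x w) y * D (u / y) <= (1 - x) * (b + x * e / 2).
  have -> : 1 - x = \sum_(y <- rem x w) y.
    by rewrite -w1 (big_rem x)//= addrAC subrr add0r.
  rewrite big_seq [X in X * _]big_seq mulr_suml; apply: ler_sum => y /mem_rem yw.
  by rewrite ler_wpM2l ?Dle// ltW ?weight_gt0.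
move: Du; rewrite (Dh u uc) (big_rem x)//= => Du rest.
have : x * (b - e) <= x * D (u / x).
  have : 0 <= e * x * x by rewrite !mulr_ge0// ltW.
  lra.
by rewrite ler_pM2l.
Qed.

(** The upper limit [b0] of [D s := M s - M (s / x)] at 0 cannot be positive:
    otherwise there are arbitrarily long chains [s, s / x, s / x ^+ 2] and so on
    along which [D] stays near [b0], and [M] would vary by more than [2 * C]. *)
Lemma self_averaging_diff_le M C x : x \in w -> self_averaging M 1 ->
  (forall s, 0 < s <= 1 -> `|M s| <= C) ->
  forall e, 0 < e -> \forall s \near (0 : R)^'+, M s - M (s / x) <= e.
Proof.
move=> xw Mh MC e e0.
have x0 := weight_gt0 xw; have x1 := weight_lt1 xw.
pose D s := M s - M (s / x).
have Dh : self_averaging D p by exact: self_averaging_diff.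
have DC s : 0 < s <= p -> `|D s| <= C + C.
  move=> /andP[s0 sp].
  have sx1 : s / x <= 1 by apply: div_weight_le; rewrite ?mulr1.
  have s1 : s <= 1 by apply: le_trans sx1; rewrite ler_pdivlMr//; nra.
  by apply: le_trans (ler_normB _ _) _; rewrite lerD ?MC ?s0// div_weight_gt0.
pose B := [set b | \forall s \near (0 : R)^'+, D s <= b].
have nearp : \forall s \near (0 : R)^'+, 0 < s <= p.
  near=> s; apply/andP; split; near: s.
    exact: nbhs_right_gt.
  exact: nbhs_right_le.
have Bne : B !=set0.
  exists (C + C); rewrite /B /=; near=> s.
  by rewrite (le_trans (ler_norm _))// DC//; near: s.
have Blb : has_inf B.
  split => //; exists (- (C + C)) => b Bb.
  have [s [sp sb]] : exists s, 0 < s <= p /\ D s <= b.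
    by have [s [? ?]] := filter_ex (filterI nearp Bb); exists s.
  apply: le_trans sb; rewrite lerNl; apply: le_trans (DC _ sp).
  by rewrite -normrN ler_norm.
pose b0 := inf B.
have eventually_le r : b0 < r -> \forall s \near (0 : R)^'+, D s <= r.
  move=> br; have [b Bb bl] := inf_adherent (eps := r - b0) ltac:(by rewrite subr_gt0) Blb.
  have {}bl : b <= r by rewrite -/b0 in bl; lra.
  by apply: filterS Bb => s /le_trans; apply.
have [b0le|b0gt] := leP b0 0.
  by apply: eventually_le; lra.
exfalso.
(* The last clause keeps the end of the chain near the maximum, so that the
   chain can be prolonged; [r] is universally quantified because one more step
   requires a better approximation on the previous ones. *)
have claim m : forall r d, 0 < r -> 0 < d -> exists s, [/\ 0 < s < d,
    m%:R * (b0 - r) <= M s - M (s / x ^+ m) & b0 - r <= D (s / x ^+ m)].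
  elim: m => [|m IH] r d r0 d0.
    have nB : ~ B (b0 - r).
      by move=> /(ge_inf (proj2 Blb)); rewrite -/b0; lra.
    apply: contrapT => nex; apply: nB; rewrite /B /=.
    near=> s; rewrite leNgt; apply/negP => Ds; apply: nex; exists s.
    rewrite expr0 divr1 mul0r subrr; split=> //; last by rewrite ltW.
    apply/andP; split=> //.
  have r'0 : 0 < x * r / 2 by rewrite divr_gt0 ?mulr_gt0.
  have := eventually_le (b0 + x * r / 2) ltac:(lra).
  move=> /filterI /(_ nearp).
  rewrite !near_simpl /= => -[d1 /= d10 Hd1].
  have small s : 0 < s < d1 -> D s <= b0 + x * r / 2 /\ 0 < s <= p.
    move=> /andP[s0 sd]; apply: Hd1 => //=.
    by rewrite sub0r normrN gtr0_norm.
  have xm0 : 0 < x ^+ m by rewrite exprn_gt0.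
  have xm1 : x ^+ m <= 1 by rewrite exprn_ile1// ltW.
  have p1 : p <= 1 by have /andP[] := wp xw; lra.
  (* The chain multiplies [s] by [1 / x ^+ m], and the averaging step by at most
     [1 / p]; all these points must stay below [d1]. *)
  pose d' := Num.min d (d1 * p * x ^+ m).
  have [s [/andP[s0 sd'] Ms Ds]] := IH (x * r / 2) d' r'0
    ltac:(by rewrite lt_min d0 !mulr_gt0).
  move: sd'; rewrite lt_min => /andP[sd sd1].
  pose u := s / x ^+ m.
  have u0 : 0 < u by rewrite divr_gt0.
  have ud1 : u < d1 * p by rewrite ltr_pdivrMr.
  have [_ up] : D u <= b0 + x * r / 2 /\ 0 < u <= p.
    by apply: small; rewrite u0 (lt_le_trans ud1)//; nra.
  have next : b0 - r <= D (u / x).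
    apply: (self_averaging_near_max xw Dh up r0 Ds) => y yw.
    apply: (proj1 (small _ _)); rewrite div_weight_gt0//=.
    rewrite ltr_pdivrMr ?weight_gt0// (lt_le_trans ud1)// ler_pM2l//.
    by have /andP[] := wp yw.
  have E : s / x ^+ m.+1 = u / x by rewrite exprSr invfM mulrA.
  exists s; rewrite s0 sd E; split=> //.
  have xr : x * r / 2 <= r by nra.
  have : m%:R * (b0 - r) <= m%:R * (b0 - x * r / 2).
    by rewrite ler_wpM2l//; lra.
  move: Ds; rewrite {1}/D -/u; move: Ms; rewrite -/u -[m.+1%:R]natr1 mulrDl mul1r.
  lra.
(* With [r := b0 / 2], a chain of [m] steps rises by at least [m * (b0 / 2)]. *)
pose m := (Num.truncn ((C + C) / (b0 / 2))).+1.
have [s [/andP[s0 sd]]] := claim m (b0 / 2) (x ^+ m) ltac:(lra) ltac:(by rewrite exprn_gt0).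
have xm1 : x ^+ m <= 1 by rewrite exprn_ile1// ltW.
have b20 : 0 < b0 / 2 by lra.
have mlt : C + C < m%:R * (b0 / 2).
  by rewrite -ltr_pdivrMr// truncnS_gt.
have -> : b0 - b0 / 2 = b0 / 2 by lra.
move=> /(lt_le_trans mlt) + _; apply/negP; rewrite -leNgt.
apply: le_trans (ler_norm _) _; apply: le_trans (ler_normB _ _) _.
apply: lerD; apply: MC.
  by rewrite s0 (le_trans (ltW sd)).
by rewrite divr_gt0 ?exprn_gt0//= ler_pdivrMr ?exprn_gt0// mul1r ltW.
Unshelve. all: by end_near.
Qed.

Lemma self_averaging_diff_cvg M C x : x \in w -> self_averaging M 1 ->
  (forall s, 0 < s <= 1 -> `|M s| <= C) ->
  M s - M (s / x) @[s --> 0^'+] --> 0.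
Proof.
move=> xw Mh MC; apply/cvgr0Pnorm_le => e e0.
have h1 := self_averaging_diff_le xw Mh MC e0.
have Nh : self_averaging (fun s => - M s) 1.
  move=> s /Mh ->; rewrite -sumrN; apply: eq_bigr => y _.
  by rewrite mulrN.
have NC s : 0 < s <= 1 -> `|- M s| <= C by rewrite normrN; exact: MC.
have h2 := self_averaging_diff_le xw Nh NC e0.
near=> s; rewrite ler_norml; apply/andP; split; last by near: s.
have : - M s - - M (s / x) <= e by near: s.
by lra.
Unshelve. all: by end_near.
Qed.

End Renewal.

(** * Intervals of a partition *)

Section Intervals.
Variable R : realType.
Implicit Types (a b : R) (l : seq R) (h : R -> R -> seq R) (J K : R * R).

(** A subdivision of an interval starting at [a] is its list of right endpoints;
    sums over consecutive endpoints become sums over this list of pairs. *)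
Definition intervals a l : seq (R * R) := pairmap pair a l.

Definition width J := J.2 - J.1.

Definition expand h a l := flatten (pairmap h a l).

Lemma pairmapE T (g : R -> R -> T) a l :
  pairmap g a l = [seq g J.1 J.2 | J <- intervals a l].
Proof. by elim: l a => [//|b l IH] a /=; rewrite IH. Qed.

Lemma expandE h a l :
  expand h a l = flatten [seq h J.1 J.2 | J <- intervals a l].
Proof. by rewrite /expand pairmapE. Qed.

Lemma eq_in_expand h1 h2 a l :
  {in intervals a l, forall J, h1 J.1 J.2 = h2 J.1 J.2} ->
  expand h1 a l = expand h2 a l.
Proof. by move=> h12; rewrite !expandE; congr flatten; exact/eq_in_map. Qed.

Lemma expand_leaf a l : expand (fun _ b => [:: b]) a l = l.
Proof. by elim: l a => [//|b l IH] a; rewrite /expand/= -/(expand _ _ _) IH. Qed.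

Lemma map_snd_intervals a l : [seq J.2 | J <- intervals a l] = l.
Proof. by rewrite -(pairmapE (fun _ y => y)); elim: l a => //= b l IH a; rewrite IH. Qed.

Lemma size_intervals a l : size (intervals a l) = size l.
Proof. exact: size_pairmap. Qed.

Lemma intervals_map (f : R -> R) a l :
  intervals (f a) (map f l) = [seq (f J.1, f J.2) | J <- intervals a l].
Proof. by elim: l a => //= b l IH a; rewrite IH. Qed.

Lemma intervals_cat a l1 l2 :
  intervals a (l1 ++ l2) = intervals a l1 ++ intervals (last a l1) l2.
Proof. by rewrite /intervals pairmap_cat. Qed.

Lemma intervals_expand h a l :
  {in intervals a l, forall J, last J.1 (h J.1 J.2) = J.2} ->
  intervals a (expand h a l) =
  flatten [seq intervals J.1 (h J.1 J.2) | J <- intervals a l].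
Proof.
elim: l a => [//|b l IH] a hl; rewrite /expand/= -/(expand _ _ _) intervals_cat.
rewrite (hl (a, b)) ?inE ?eqxx// IH// => J Jl; apply: hl.
by rewrite inE Jl orbT.
Qed.

Lemma expand_expand h1 h2 a l :
  {in intervals a l, forall J, last J.1 (h1 J.1 J.2) = J.2} ->
  expand h2 a (expand h1 a l) = expand (fun x y => expand h2 x (h1 x y)) a l.
Proof.
move=> hl; rewrite [LHS]expandE intervals_expand// map_flatten -map_comp.
rewrite expandE; elim: (intervals a l) => //= J s IH.
by rewrite flatten_cat IH expandE.
Qed.

Lemma itv_partition_in a b l : itv_partition a b l ->
  {in intervals a l, forall J, [/\ a <= J.1, J.1 < J.2 & J.2 <= b]}.
Proof.
elim: l a => [//|c l IH] a abl J; rewrite inE => /predU1P[->|Jl]/=.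
  split=> //; first by case: abl => /= /andP[].
  exact: itv_partition_le (itv_partition_cons abl).
have [cJ J12 Jb] := IH _ (itv_partition_cons abl) _ Jl.
split=> //; apply: le_trans cJ; case: abl => /= /andP[/ltW//].
Qed.

Lemma itv_partition_expand h a b l : itv_partition a b l ->
  {in intervals a l, forall J, itv_partition J.1 J.2 (h J.1 J.2)} ->
  itv_partition a b (expand h a l).
Proof.
elim: l a => [//|c l IH] a abl hl; rewrite /expand/= -/(expand _ _ _).
apply: (itv_partition_cat (b := c)).
  by apply: (hl (a, c)); rewrite inE eqxx.
apply: IH (itv_partition_cons abl) _ => J Jl.
by apply: hl; rewrite inE Jl orbT.
Qed.

Lemma itv_partition_last a b l : itv_partition a b l -> last a l = b.
Proof. by case=> _ /eqP. Qed.

Lemma telescope_intervals (F : R -> R) a b l : itv_partition a b l ->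
  \sum_(J <- intervals a l) (F J.2 - F J.1) = F b - F a.
Proof.
move/itv_partition_last => <-; elim: l a => [|c l IH] a /=.
  by rewrite big_nil subrr.
by rewrite big_cons IH /=; lra.
Qed.

Lemma sum_expand (g : R -> R) h a l :
  \sum_(t <- expand h a l) g t =
  \sum_(J <- intervals a l) \sum_(t <- h J.1 J.2) g t.
Proof. by rewrite expandE big_flatten big_map. Qed.

Lemma size_expand h a l :
  size (expand h a l) = (\sum_(J <- intervals a l) size (h J.1 J.2))%N.
Proof.
rewrite expandE size_flatten /shape -map_comp sumnE big_map.
by apply: eq_bigr.
Qed.

End Intervals.

Section Mesh.
Variable R : realType.
Implicit Types pi : partition01 R.

Lemma width_gt0 pi : {in intervals 0 pi, forall J, 0 < width J}.
Proof. by move=> J /(itv_partition_in (pointsP pi))[_ ? _]; rewrite subr_gt0. Qed.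

Lemma sum_width pi : \sum_(J <- intervals 0 pi) width J = 1.
Proof. by rewrite (telescope_intervals id (pointsP pi)) subr0. Qed.

Lemma meshE pi : mesh pi = \big[Num.max/0]_(J <- intervals 0 pi) width J.
Proof. by rewrite /mesh pairmapE big_map. Qed.

Lemma width_le_mesh pi : {in intervals 0 pi, forall J, width J <= mesh pi}.
Proof. by move=> J Jpi; rewrite meshE; exact: le_bigmax_seq. Qed.

Lemma mesh_attained pi : exists2 J, J \in intervals 0 pi & width J = mesh pi.
Proof.
have [//|no] := pselect (exists2 J, J \in intervals 0 pi & width J = mesh pi).
have pos := @width_gt0 pi; have := sum_width pi.
case E : (intervals 0 pi) => [|K s]; first by rewrite big_nil => /esym/eqP; rewrite oner_eq0.
move=> _.
have : mesh pi < mesh pi; last by rewrite ltxx.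
have Kpi : K \in intervals 0 pi by rewrite E mem_head.
rewrite {1}meshE big_seq; apply: bigmax_lt.
  by apply: lt_le_trans (pos _ Kpi) (width_le_mesh Kpi).
move=> J Jpi; rewrite lt_neqAle width_le_mesh// andbT.
by apply/eqP => Jm; apply: no; exists J.
Qed.

Lemma mesh_gt0 pi : 0 < mesh pi.
Proof. by have [J Jpi <-] := mesh_attained pi; exact: width_gt0 Jpi. Qed.

Lemma refine_pointsE rho pi : refine rho pi = expand (fun a b =>
  if b - a == mesh pi then subdivide rho a b else [:: b]) 0 pi :> seq R.
Proof. by []. Qed.

Lemma size_refine rho pi : nontrivial rho -> (size pi < size (refine rho pi))%N.
Proof.
move=> rho2; have [J0 J0pi J0m] := mesh_attained pi.
rewrite refine_pointsE size_expand -(size_intervals 0 pi) -sum1_size.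
rewrite (big_rem J0)//= [X in (_ < X)%N](big_rem J0)//=.
rewrite -/(width J0) J0m eqxx -addSn leq_add//.
  by rewrite size_map.
apply: leq_sum => J _; case: ifP => // _; rewrite size_map.
exact: ltnW.
Qed.

(** The lengths of a non-trivial partition are at most [1 - p] because at least
    one other interval, of length at least [p], is left. *)
Lemma width_bounds rho : nontrivial rho ->
  exists2 p : R, 0 < p & {in intervals 0 rho, forall K, p <= width K <= 1 - p}.
Proof.
move=> rho2.
have [p p0 pK] : exists2 p : R, 0 < p & {in intervals 0 rho, forall K, p <= width K}.
  have := @width_gt0 rho; elim: (intervals 0 rho) => [|K s IH] pos; first by exists 1.
  have [|p p0 pK] := IH; first by move=> J Js; apply: pos; rewrite inE Js orbT.
  exists (Num.min p (width K)); first by rewrite lt_min p0 pos ?mem_head.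
  by move=> J; rewrite inE ge_min => /predU1P[->|/pK ->//]; rewrite lexx orbT.
exists p => // K Krho; rewrite pK//=.
have : (0 < size (rem K (intervals 0 rho)))%N.
  by rewrite size_rem// size_intervals -ltnS prednK// (ltn_trans _ rho2).
case E : (rem K (intervals 0 rho)) => [//|L s] _.
have sub J : J \in L :: s -> J \in intervals 0 rho by rewrite -E; exact: mem_rem.
have := sum_width rho; rewrite (big_rem K)//= E big_cons.
have := pK _ (sub L (mem_head _ _)).
have : 0 <= \sum_(J <- s) width J.
  rewrite big_seq; apply: sumr_ge0 => J Js.
  by apply/ltW/(@width_gt0 rho)/sub; rewrite inE Js orbT.
by lra.
Qed.

End Mesh.

(** * Riemann sums of continuous functions *)

Section Continuous.
Variable R : realType.
Let mu := @lebesgue_measure R.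
Variables (f : R -> R) (c d : R).
Hypothesis fc : {within `[c, d], continuous f}.

(** Heine's theorem, with one-sided neighborhoods of 0 as the filter of moduli
    in the near-covering form of compactness. *)
Lemma segment_uniform_continuity (e : R) : 0 < e -> exists2 r : R, 0 < r &
  {in `[c, d] &, forall x y, `|x - y| < r -> `|f x - f y| <= e}.
Proof.
move=> e0; move/subspace_continuousP : fc => fx.
pose P (r x : R) := {in `[c, d], forall y, `|x - y| < r -> `|f x - f y| <= e}.
have /compact_near_coveringP/near_covering_withinP cover := @segment_compact R c d.
have : \forall r \near (0 : R)^'+, `[c, d] `<=` P r.
  apply: cover => x xcd.
  have /cvgrPdist_le /(_ (e / 2)) := fx _ xcd; rewrite divr_gt0// => /(_ isT).
  rewrite near_withinE => -[h /= h0 fh].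
  exists ([set x' | `|x - x'| < h / 2], [set r | 0 < r < h / 2]).
    split; first by exists (h / 2); rewrite /= ?divr_gt0.
    near=> r; apply/andP; split=> //.
    by near: r; apply: nbhs_right_lt; rewrite divr_gt0.
  move=> [x' r] /= [xx' /andP[r0 rh]] x'cd y ycd x'y.
  have d1 : `|f x - f x'| <= e / 2 by apply: fh => //=; lra.
  have d2 : `|f x - f y| <= e / 2.
    apply: fh => //=; apply: le_lt_trans (ler_distD x' _ _) _; lra.
  apply: le_trans (ler_distD (f x) _ _) _.
  by rewrite [`|f x' - f x|]distrC; lra.
move=> cov; have [r [r0 Pr]] := filter_ex (filterI (nbhs_right_gt (0 : R)) cov).
by exists r => // x y xcd; apply: Pr.
Unshelve. all: by end_near. Qed.

Lemma segment_integrable : mu.-integrable `[c, d] (EFin \o f).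
Proof. by apply: continuous_compact_integrable => //; exact: segment_compact. Qed.

Lemma integral_near_constant a b e : c <= a -> a < b -> b <= d ->
  {in `[a, b], forall x, `|f x - f b| <= e} ->
  `|\int[mu]_(x in `]a, b]) f x - f b * (b - a)| <= e * (b - a).
Proof.
move=> ca ab bd fe.
have sub : `]a, b] `<=` `[c, d].
  by move=> x /=; rewrite !in_itv/= => /andP[? ?]; apply/andP; split; lra.
have itf : mu.-integrable `]a, b] (EFin \o f).
  by apply: integrableS segment_integrable.
have itc (k : R) : mu.-integrable `]a, b] (EFin \o cst k).
  apply: (@integrableS _ _ _ mu `[a, b]) => //.
    by move=> x /=; rewrite !in_itv/= => /andP[? ?]; apply/andP; split; lra.
  apply: continuous_compact_integrable; first exact: segment_compact.
  by apply: continuous_subspaceT => x; exact: cvg_cst.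
have intc k : \int[mu]_(x in `]a, b]) (cst k x) = k * (b - a).
  have mab : mu `]a, b]%classic = (b - a)%:E.
    by rewrite [LHS]lebesgue_measure_itv/= lte_fin ab.
  by rewrite Rintegral_cst//; exact: (congr1 (fun z => k * fine z) mab).
have fe' x : `]a, b]%classic x -> f b - e <= f x <= f b + e.
  move=> /= xab; have /fe : x \in `[a, b] by exact: subset_itv_oc_cc.
  by rewrite ler_distl.
rewrite ler_distl -mulrBl -mulrDl -!intc; apply/andP.
by split; apply: le_Rintegral => // x /fe' /andP[].
Qed.

Lemma integral_intervals l : itv_partition c d l -> 
  \int[mu]_(x in `[c, d]) f x =
  \sum_(J <- intervals c l) \int[mu]_(x in `]J.1, J.2]) f x.
Proof.
move=> cdl; pose F x := \int[mu]_(t in `[c, x]) f t.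
have Fc : F c = 0 by rewrite /F set_itv1 Rintegral_set1.
rewrite -[LHS]subr0 -[X in _ - X = _]Fc -(telescope_intervals F cdl).
rewrite big_seq [RHS]big_seq; apply: eq_bigr => J Jl.
have [cJ J12 Jd] := itv_partition_in cdl Jl.
rewrite /F Rintegral_itvB ?bnd_simp//; last exact: ltW.
apply: integrableS segment_integrable => //.
by move=> x /=; rewrite !in_itv/= => /andP[? ?]; apply/andP; split; lra.
Qed.

Lemma riemann_sum_near e r l :
  {in `[c, d] &, forall x y, `|x - y| < r -> `|f x - f y| <= e} ->
  itv_partition c d l -> {in intervals c l, forall J, width J < r} ->
  `|\int[mu]_(x in `[c, d]) f x - \sum_(J <- intervals c l) f J.2 * width J|
    <= e * (d - c).
Proof.
move=> fe cdl lr; rewrite (integral_intervals cdl) -sumrB.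
rewrite -(telescope_intervals id cdl) mulr_sumr.
apply: le_trans (ler_norm_sum _ _ _) _.
rewrite big_seq [leRHS]big_seq; apply: ler_sum => J Jl.
have [cJ J12 Jd] := itv_partition_in cdl Jl.
apply: integral_near_constant => // x; rewrite in_itv/= => /andP[J1x xJ2].
apply: fe; rewrite ?in_itv/=; first by apply/andP; split; lra.
  by apply/andP; split; lra.
have := lr _ Jl; rewrite /width ler0_norm; lra.
Qed.

End Continuous.

(** * Splitting down to a given scale *)

Section Splitting.
Variables (R : realType) (rho : partition01 R) (p : R).
Hypotheses (p0 : 0 < p)
  (rhop : {in intervals 0 rho, forall K, p <= width K <= 1 - p}).

Implicit Types (s a b : R) (J K : R * R).

(** [d] bounds the depth of the recursion. *)
Fixpoint split_fuel d s a b : seq R :=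
  if d is d'.+1 then
    if s <= b - a then expand (split_fuel d' s) a (subdivide rho a b)
    else [:: b]
  else [:: b].

(** Splitting an interval of length at least [s] shortens it by at least
    [p * s], so [(b - a) / (p * s)] bounds the number of successive splittings.
    The bound depends on [(b - a) / s] only, which makes [split_to] covariant
    under affine maps. *)
Definition split_to s a b :=
  split_fuel (Num.truncn ((b - a) / (p * s))).+1 s a b.

Lemma intervals_subdivide a b : intervals a (subdivide rho a b) =
  [seq (a + (b - a) * K.1, a + (b - a) * K.2) | K <- intervals 0 rho].
Proof.
by rewrite -(intervals_map (fun r => a + (b - a) * r)) mulr0 addr0.
Qed.

Lemma subdivide_lt a b J : a < b -> J \in intervals a (subdivide rho a b) ->
  J.1 < J.2.
Proof. by move=> ab /(itv_partition_in (subdivideP _ ab))[]. Qed.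

Lemma width_subdivide a b J : J \in intervals a (subdivide rho a b) ->
  exists2 K, K \in intervals 0 rho & width J = (b - a) * width K.
Proof.
rewrite intervals_subdivide => /mapP[K Krho ->]; exists K => //.
by rewrite /width/=; ring.
Qed.

Lemma width_subdivide_le a b J : a < b ->
  J \in intervals a (subdivide rho a b) -> J.2 - J.1 <= (b - a) - p * (b - a).
Proof.
move=> ab /width_subdivide[K /rhop/andP[_ Kp]]; rewrite {1}/width => ->.
have : (b - a) * width K <= (b - a) * (1 - p) by rewrite ler_pM2l// subr_gt0.
lra.
Qed.

(** An interval of length less than [s + d * (p * s)] is exhausted in depth [d],
    as its children are shorter by [p * s]. *)
Lemma split_fuel_stable s d d' a b : 0 < s -> a < b ->
  b - a < s + d%:R * (p * s) -> b - a < s + d'%:R * (p * s) ->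
  split_fuel d s a b = split_fuel d' s a b.
Proof.
move=> s0; elim: d d' a b => [|d IH] [|d'] a b ab //=.
- by rewrite mul0r addr0 ltNge => /negbTE ->.
- by move=> _; rewrite mul0r addr0 ltNge => /negbTE ->.
move=> bd bd'; case: ifP => // sab; apply: eq_in_expand => J Jab.
have Jle := width_subdivide_le ab Jab.
have pp : p * s <= p * (b - a) by rewrite ler_pM2l.
have step k : b - a < s + k.+1%:R * (p * s) -> J.2 - J.1 < s + k%:R * (p * s).
  by rewrite -[k.+1%:R]natr1 mulrDl mul1r; lra.
by apply: IH; [exact: subdivide_lt Jab | exact: step..].
Qed.

Lemma split_to_eq s a b : 0 < s -> a < b ->
  split_to s a b = if s <= b - a then expand (split_to s) a (subdivide rho a b)
                else [:: b].
Proof.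
move=> s0 ab; rewrite {1}/split_to [LHS]/=; case: ifP => // sab.
rewrite /split_to; apply: eq_in_expand => J Jab; have J12 := subdivide_lt ab Jab.
have ps : 0 < p * s by rewrite mulr_gt0.
have enough x : x < s + (Num.truncn (x / (p * s))).+1%:R * (p * s).
  rewrite (@lt_trans _ _ ((Num.truncn (x / (p * s))).+1%:R * (p * s)))//.
    by rewrite -ltr_pdivrMr// truncnS_gt.
  by rewrite ltrDr.
apply: split_fuel_stable => //.
have Jle := width_subdivide_le ab Jab.
have pp : p * s <= p * (b - a) by rewrite ler_pM2l.
have := enough (b - a); rewrite -[in X in X -> _]natr1 mulrDl mul1r; lra.
Qed.

Lemma split_to_ind s (P : R -> R -> Prop) : 0 < s ->
  (forall a b, a < b -> b - a < s -> P a b) ->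
  (forall a b, a < b -> s <= b - a ->
     {in intervals a (subdivide rho a b), forall J, P J.1 J.2} -> P a b) ->
  forall a b, a < b -> P a b.
Proof.
move=> s0 Pleaf Pnode a b ab.
have ps : 0 < p * s by rewrite mulr_gt0.
have : b - a < s + (Num.truncn ((b - a) / (p * s))).+1%:R * (p * s).
  rewrite (@lt_trans _ _ ((Num.truncn ((b - a) / (p * s))).+1%:R * (p * s)))//.
    by rewrite -ltr_pdivrMr// truncnS_gt.
  by rewrite ltrDr.
move: (_.+1) => d; elim: d a b ab => [|d IH] a b ab.
  by rewrite mul0r addr0; exact: Pleaf.
move=> bd; have [sab|] := leP s (b - a); last exact: Pleaf.
apply: Pnode => // J Jab; apply: IH; first exact: subdivide_lt Jab.
have Jle := width_subdivide_le ab Jab.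
have pp : p * s <= p * (b - a) by rewrite ler_pM2l.
by move: bd; rewrite -[d.+1%:R]natr1 mulrDl mul1r; lra.
Qed.

Lemma split_to_leaf s a b : 0 < s -> a < b -> b - a < s -> split_to s a b = [:: b].
Proof. by move=> s0 ab; rewrite split_to_eq// ltNge => /negbTE ->. Qed.

Lemma split_to_node s a b : 0 < s -> a < b -> s <= b - a ->
  split_to s a b = expand (split_to s) a (subdivide rho a b).
Proof. by move=> s0 ab sab; rewrite split_to_eq// sab. Qed.

Lemma split_to_partition s a b : 0 < s -> a < b -> itv_partition a b (split_to s a b).
Proof.
move=> s0; move: a b; apply: (split_to_ind s0) => a b ab sab.
  by rewrite split_to_leaf//; exact: itv_partition1.
move=> IH; rewrite split_to_node//.
exact: itv_partition_expand (subdivideP _ ab) IH.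
Qed.

Lemma split_to_last s a b : 0 < s -> a < b -> last a (split_to s a b) = b.
Proof. by move=> s0 ab; apply: itv_partition_last; exact: split_to_partition. Qed.

Lemma last_split_to_subdivide s a b : 0 < s -> a < b ->
  {in intervals a (subdivide rho a b), forall J, last J.1 (split_to s J.1 J.2) = J.2}.
Proof. by move=> s0 ab J Jab; rewrite split_to_last// (subdivide_lt ab Jab). Qed.

(** The intervals that are split at scale [s] are also split at the finer scale
    [s'], so splitting to [s'] can be resumed from [split_to s]. *)
Lemma split_to_trans s' s a b : 0 < s' -> s' <= s -> a < b ->
  split_to s' a b = expand (split_to s') a (split_to s a b).
Proof.
move=> s'0 s's; have s0 := lt_le_trans s'0 s's.
move: a b; apply: (split_to_ind s0) => a b ab sab.
  by rewrite (split_to_leaf s0)// /expand/= cats0.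
move=> IH; rewrite split_to_node ?(le_trans s's)// (split_to_node s0)//.
rewrite expand_expand; last exact: last_split_to_subdivide.
exact: eq_in_expand.
Qed.

(** The lengths occurring in [split_to] are products of lengths of [rho]; so they
    have each property [P] that is preserved by multiplication by these. *)
Lemma split_to_intervals_ind s (P : R -> Prop) : 0 < s ->
  (forall x, P x -> {in intervals 0 rho, forall K, P (x * width K)}) ->
  forall a b, a < b -> P (b - a) ->
  {in intervals a (split_to s a b), forall J, P (width J) /\ width J < s}.
Proof.
move=> s0 Pmul; apply: (split_to_ind s0) => a b ab sab.
  by move=> Pab; rewrite split_to_leaf// => J; rewrite inE => /eqP ->.
move=> IH Pab; rewrite split_to_node// intervals_expand; last exact: last_split_to_subdivide.
move=> I /flattenP[_ /mapP[J Jab ->]] IJ; apply: (IH _ Jab) => //.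
by have [K Krho] := width_subdivide Jab; rewrite /width => ->; exact: Pmul.
Qed.

Lemma width_split_to_lt s a b : 0 < s -> a < b ->
  {in intervals a (split_to s a b), forall J, width J < s}.
Proof.
move=> s0 ab J Jab.
by have [] := split_to_intervals_ind (P := fun=> True) s0 (fun _ _ _ _ => I) ab I Jab.
Qed.

Definition nb_split_to s : nat := size (split_to s 0 1).

Lemma size_split_fuel d s a b : a < b ->
  size (split_fuel d s a b) = size (split_fuel d (s / (b - a)) 0 1).
Proof.
elim: d s a b => [//|d IH] s a b ab /=.
have ba : 0 < b - a by rewrite subr_gt0.
rewrite subr0 ler_pdivrMr// mul1r; case: ifP => // _.
rewrite !size_expand !intervals_subdivide !big_map big_seq [RHS]big_seq.
apply: eq_bigr => K /(itv_partition_in (pointsP rho))[_ K12 _] /=.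
rewrite IH; last by rewrite ltrD2l ltr_pM2l.
rewrite [RHS]IH; last by rewrite !add0r subr0 !mul1r.
rewrite !add0r subr0 !mul1r; congr (size (split_fuel _ _ _ _)).
rewrite -mulrA -invfM; congr (_ / _); lra.
Qed.

Lemma size_split_to s a b : a < b -> size (split_to s a b) = nb_split_to (s / (b - a)).
Proof.
move=> ab; rewrite /split_to size_split_fuel// /nb_split_to /split_to.
have -> // : (1 - 0) / (p * (s / (b - a))) = (b - a) / (p * s).
by rewrite subr0 div1r mulrA invfM invrK mulrC.
Qed.

Lemma nb_split_to_rec s : 0 < s <= 1 ->
  nb_split_to s = (\sum_(K <- intervals 0 rho) nb_split_to (s / width K))%N.
Proof.
move=> /andP[s0 s1]; rewrite /nb_split_to split_to_node ?ltr01 ?subr0//.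
have -> : subdivide rho 0 1 = rho.
  rewrite /subdivide -[RHS]map_id; apply: eq_map => r.
  by rewrite add0r subr0 mul1r.
rewrite size_expand big_seq [RHS]big_seq; apply: eq_bigr => K.
by move=> /(itv_partition_in (pointsP rho))[_ K12 _]; rewrite size_split_to.
Qed.

(** The lengths of [split_to s] are less than [s], so between the scales [s] and
    [mesh pi] only the intervals of maximal length are split. They are split once,
    because their children are strictly shorter. *)
Lemma refine_split_to (pi : partition01 R) s : 0 < s -> pi = split_to s 0 1 :> seq R ->
  refine rho pi = split_to (mesh pi) 0 1 :> seq R.
Proof.
move=> s0 pis; have m0 := mesh_gt0 pi.
have ms : mesh pi <= s.
  have [J Jpi <-] := mesh_attained pi; rewrite pis in Jpi.
  by rewrite ltW// (width_split_to_lt s0 ltr01 Jpi).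
rewrite (split_to_trans m0 ms ltr01) -pis refine_pointsE.
apply: eq_in_expand => J Jpi.
have [_ J12 _] := itv_partition_in (pointsP pi) Jpi.
case: eqVneq => [Jm|Jm]; last first.
  by rewrite split_to_leaf// lt_neqAle Jm (width_le_mesh Jpi).
rewrite split_to_node ?Jm// -[LHS](expand_leaf J.1); apply: eq_in_expand => K KJ.
have K12 := subdivide_lt J12 KJ.
rewrite split_to_leaf// (le_lt_trans (width_subdivide_le J12 KJ))//.
by rewrite Jm ltrBlDr ltrDl mulr_gt0.
Qed.

Lemma iter_refine_split_to n : exists2 s, 0 < s &
  iter n (refine rho) trivial_partition = split_to s 0 1 :> seq R.
Proof.
elim: n => [|n [s s0 IH]].
  (* At any scale above 1, [0, 1] is left whole. *)
  by exists 2; rewrite // split_to_leaf// subr0 ltr1n.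
exists (mesh (iter n (refine rho) trivial_partition)); first exact: mesh_gt0.
exact: refine_split_to s0 IH.
Qed.

(** * The asymptotic number of intervals *)

Definition weighted_count (s : R) : R := s * (nb_split_to s)%:R.

(** An interval of [split_to s] is either the initial one or a child of an
    interval of length at least [s]. *)
Lemma width_split_to_ge s a b : 0 < s -> a < b -> p * s <= b - a ->
  {in intervals a (split_to s a b), forall J, p * s <= width J}.
Proof.
move=> s0; move: a b; apply: (split_to_ind s0) => a b ab sab.
  by move=> psab; rewrite [split_to _ _ _]split_to_leaf// => J; rewrite inE => /eqP ->.
move=> IH _; rewrite [split_to _ _ _](split_to_node)// intervals_expand; last first.
  exact: last_split_to_subdivide.
move=> I /flattenP[_ /mapP[J Jab ->]] IJ; apply: (IH _ Jab) => //.
have [K /rhop/andP[pK _]] := width_subdivide Jab; rewrite {1}/width => ->.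
by rewrite mulrC ler_pM// ltW.
Qed.

Lemma sum_width_split_to s : 0 < s -> \sum_(J <- intervals 0 (split_to s 0 1)) width J = 1.
Proof.
by move=> s0; rewrite (telescope_intervals id (split_to_partition s0 ltr01)) subr0.
Qed.

Lemma weighted_countE s :
  weighted_count s = \sum_(J <- intervals 0 (split_to s 0 1)) s.
Proof.
by rewrite big_const_seq count_predT size_intervals iter_addr_0 -mulr_natr.
Qed.

(** The [nb_split_to s] lengths add up to 1, and each is less than [s]. *)
Lemma weighted_count_ge1 s : 0 < s -> 1 <= weighted_count s.
Proof.
move=> s0; rewrite weighted_countE -[leLHS](sum_width_split_to s0) big_seq [leRHS]big_seq.
apply: ler_sum => J Js; apply/ltW; exact: width_split_to_lt Js.
Qed.

Lemma weighted_count_le s : 0 < s -> p * s <= 1 -> weighted_count s <= p^-1.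
Proof.
move=> s0 ps; rewrite -div1r ler_pdivlMr// mulrC weighted_countE mulr_sumr.
rewrite -[leRHS](sum_width_split_to s0) big_seq [leRHS]big_seq.
by apply: ler_sum => J Js; apply: width_split_to_ge Js => //; rewrite subr0.
Qed.

Lemma width_lb_lt1 : p < 1.
Proof.
have [J Jrho _] := mesh_attained rho; have /andP[_ Jp] := rhop Jrho.
have := width_gt0 Jrho; lra.
Qed.

Definition ratios := [seq width K | K <- intervals 0 rho].

Lemma ratios_bound : {in ratios, forall x, p <= x <= 1 - p}.
Proof. by move=> _ /mapP[K /rhop Kp ->]. Qed.

Lemma sum_ratios : \sum_(x <- ratios) x = 1.
Proof. by rewrite big_map sum_width. Qed.

(** The factor [s] turns the sum in [nb_split_to_rec] into a weighted average. *)
Lemma weighted_count_self_averaging : self_averaging ratios weighted_count 1.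
Proof.
move=> s s01; have /andP[s0 s1] := s01.
rewrite /weighted_count [X in _ * X%:R](nb_split_to_rec s01) natr_sum mulr_sumr.
rewrite big_map big_seq [RHS]big_seq; apply: eq_bigr => K /width_gt0 K0.
by rewrite mulrA mulrCA divff ?mulr1// gt_eqF.
Qed.

(** The lengths [x] for which an interval of length [x] receives asymptotically
    the proportion [x] of all intervals, by [nb_split_to_ratio_cvg] below. *)
Definition invariant_ratio x :=
  0 < x /\ weighted_count s - weighted_count (s / x) @[s --> 0^'+] --> 0.

Lemma div_cvg_right0 (x : R) : 0 < x -> s / x @[s --> 0^'+] --> (0 : R)^'+.
Proof.
move=> x0 A [r /= r0 rA]; exists (r * x) => /=; first by rewrite mulr_gt0.
move=> s /=; rewrite sub0r normrN => sr s0; apply: rA; last by rewrite divr_gt0.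
by rewrite /= sub0r normrN normrM normfV (gtr0_norm x0) ltr_pdivrMr.
Qed.

Lemma invariant_ratio1 : invariant_ratio 1.
Proof.
split=> //; apply: cvg_near_cst; apply: nearW => s.
by rewrite divr1 subrr.
Qed.

Lemma invariant_ratioM x K : invariant_ratio x -> K \in intervals 0 rho ->
  invariant_ratio (x * width K).
Proof.
move=> [x0 cx] Krho; have K0 := width_gt0 Krho; split; first by rewrite mulr_gt0.
have Kr : width K \in ratios by apply/mapP; exists K.
have cK : weighted_count s - weighted_count (s / width K) @[s --> 0^'+] --> 0.
  apply: (self_averaging_diff_cvg p0 ratios_bound sum_ratios Kr weighted_count_self_averaging
            (C := p^-1)) => s /andP[s0 s1].
  rewrite ger0_norm; last by rewrite (le_trans ler01)// weighted_count_ge1.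
  apply: weighted_count_le => //; have := width_lb_lt1; nra.
have cK' := cvg_comp _ _ (div_cvg_right0 x0) cK.
rewrite -[X in _ --> X](addr0 0); under eq_fun => s.
  rewrite invfM mulrA -(subrK (weighted_count (s / x)) (weighted_count s)) -addrA.
  over.
exact: cvgD cx cK'.
Qed.

Lemma nb_split_to_gt0 s : 0 < s -> 0 < (nb_split_to s)%:R :> R.
Proof.
move=> s0; rewrite -(pmulr_rgt0 _ s0).
exact: lt_le_trans (weighted_count_ge1 s0).
Qed.

(** [x - N (s / x) / N s = x * (M s - M (s / x)) / M s], where [M s >= 1]. *)
Lemma nb_split_to_ratio_cvg x : invariant_ratio x ->
  (nb_split_to (s / x))%:R / (nb_split_to s)%:R @[s --> 0^'+] --> x.
Proof.
move=> [x0 /cvgr0Pnorm_le cx]; apply/cvgrPdist_le => e e0.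
have := cx (e / x) ltac:(by rewrite divr_gt0).
move=> cxe; near=> s.
have s0 : 0 < s by [].
have N0 := nb_split_to_gt0 s0.
have -> : x - (nb_split_to (s / x))%:R / (nb_split_to s)%:R =
    x * (weighted_count s - weighted_count (s / x)) / weighted_count s.
  by rewrite /weighted_count; field; rewrite !gt_eqF.
have W1 := weighted_count_ge1 s0; have W0 := lt_le_trans ltr01 W1.
rewrite !normrM (gtr0_norm x0) normfV (gtr0_norm W0) ler_pdivrMr//.
have : `|weighted_count s - weighted_count (s / x)| <= e / x by near: s.
rewrite ler_pdivlMr// mulrC => /le_trans; apply.
by rewrite ler_peMr// ltW.
Unshelve. all: by end_near. Qed.

Lemma invariant_ratio_width s : 0 < s ->
  {in intervals 0 (split_to s 0 1), forall J, invariant_ratio (width J)}.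
Proof.
move=> s0 J Js.
have [] // := split_to_intervals_ind s0 (P := invariant_ratio) _ ltr01 _ Js.
  by move=> x xi K Krho; exact: invariant_ratioM.
by rewrite subr0; exact: invariant_ratio1.
Qed.

(** * Uniform distribution *)

(** The points of [split_to s a b] are within [r] of [b], and
    [nb_split_to (s / (b - a))] is their number. *)
Lemma sum_split_to_near (f : R -> R) e r s a b : 
  {in `[0, 1] &, forall x y, `|x - y| < r -> `|f x - f y| <= e} ->
  0 < s -> 0 <= a -> a < b -> b <= 1 -> b - a < r ->
  `|\sum_(t <- split_to s a b) f t - f b * (nb_split_to (s / (b - a)))%:R| <=
    e * (nb_split_to (s / (b - a)))%:R.
Proof.
move=> fe s0 a0 ab b1 abr.
rewrite -size_split_to//.
have ends : {in split_to s a b, forall t, a <= t <= b}.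
  move=> t; rewrite -{1}(map_snd_intervals a (split_to s a b)) => /mapP[J Js ->].
  have [aJ J12 Jb] := itv_partition_in (split_to_partition s0 ab) Js.
  by rewrite Jb (le_trans aJ)// ltW.
have cst (k : R) : k * (size (split_to s a b))%:R = \sum_(t <- split_to s a b) k.
  by rewrite big_const_seq count_predT iter_addr_0 mulr_natr.
rewrite !cst -sumrB; apply: le_trans (ler_norm_sum _ _ _) _.
rewrite big_seq [leRHS]big_seq; apply: ler_sum => t /ends /andP[at_ tb].
apply: fe; rewrite ?in_itv/=; first by apply/andP; split; lra.
  by apply/andP; split; lra.
by rewrite ler0_norm; lra.
Qed.

(** The three errors of [e / 3] come from replacing the integral by the Riemann
    sum over the fixed partition [split_to r 0 1], the length of each [J] by its
    share of the points of [split_to s 0 1], and the values of [f] at these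
    points by [f J.2]. *)
Lemma split_to_equidistributed (f : R -> R) : {within `[0, 1], continuous f} ->
  (nb_split_to s)%:R^-1 * \sum_(t <- split_to s 0 1) f t @[s --> 0^'+] -->
    \int[lebesgue_measure]_(t in `[0, 1]) f t.
Proof.
move=> fc; apply/cvgrPdist_le => e e0.
have e3 : 0 < e / 3 by rewrite divr_gt0.
have [r r0 fr] := segment_uniform_continuity fc e3.
pose Q := intervals 0 (split_to r 0 1).
have Qp := split_to_partition r0 ltr01.
have Qin := itv_partition_in Qp.
have Qr : {in Q, forall J, width J < r}.
  by move=> J JQ; exact: width_split_to_lt JQ.
have := riemann_sum_near fc fr Qp Qr; rewrite subr0 mulr1 -/Q => riemann.
have cvg_coarse : \sum_(J <- Q) f J.2 * ((nb_split_to (s / width J))%:R / (nb_split_to s)%:R)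
    @[s --> 0^'+] --> \sum_(J <- Q) f J.2 * width J.
  rewrite [X in _ --> X]big_seq.
  under eq_fun do rewrite big_seq.
  apply: cvg_big => [|J JQ]; first exact: add_continuous.
  by apply: cvgMr; apply: nb_split_to_ratio_cvg; exact: invariant_ratio_width JQ.
have /cvgrPdist_le /(_ _ e3) coarse := cvg_coarse.
near=> s.
have s0 : 0 < s by [].
have sr : s <= r by near: s; exact: nbhs_right_le.
have N0 := nb_split_to_gt0 s0.
have fine : `|\sum_(J <- Q) f J.2 * ((nb_split_to (s / width J))%:R / (nb_split_to s)%:R) -
              (nb_split_to s)%:R^-1 * \sum_(t <- split_to s 0 1) f t| <= e / 3.
  have sE : split_to s 0 1 = expand (split_to s) 0 (split_to r 0 1).
    exact: split_to_trans.
  have countE : (nb_split_to s)%:R = \sum_(J <- Q) (nb_split_to (s / width J))%:R :> R.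
    rewrite /nb_split_to sE size_expand natr_sum.
    rewrite big_seq [RHS]big_seq; apply: eq_bigr => J /Qin[_ J12 _].
    by rewrite size_split_to.
  rewrite sE sum_expand -/Q.
  rewrite [X in X - _](_ : _ =
      (nb_split_to s)%:R^-1 * \sum_(J <- Q) f J.2 * (nb_split_to (s / width J))%:R); last first.
    rewrite mulr_sumr; apply: eq_bigr => J _; ring.
  rewrite -mulrBr normrM gtr0_norm ?invr_gt0// mulrC ler_pdivrMr// distrC -sumrB.
  apply: le_trans (ler_norm_sum _ _ _) _; rewrite [in leRHS]countE mulr_sumr.
  rewrite big_seq [leRHS]big_seq; apply: ler_sum => J JQ.
  have [J1 J12 J2] := Qin _ JQ.
  by apply: (sum_split_to_near fr) => //; exact: Qr JQ.
have close : `|\sum_(J <- Q) f J.2 * width J -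
    \sum_(J <- Q) f J.2 * ((nb_split_to (s / width J))%:R / (nb_split_to s)%:R)| <= e / 3.
  by near: s.
have -> : e = e / 3 + (e / 3 + e / 3) by lra.
apply: le_trans (ler_distD (\sum_(J <- Q) f J.2 * width J) _ _) _.
apply: lerD => //.
apply: le_trans (ler_distD (\sum_(J <- Q) f J.2 * ((nb_split_to (s / width J))%:R / (nb_split_to s)%:R)) _ _) _.
exact: lerD.
Unshelve. all: by end_near. Qed.

Hypothesis hrho : nontrivial rho.
Let pi_ n := iter n (refine rho) trivial_partition.

Lemma size_iter_refine n : (n < size (pi_ n))%N.
Proof.
by elim: n => [//|n IH]; exact: leq_ltn_trans IH (size_refine (pi_ n) hrho).
Qed.

Lemma iter_refine_mesh n : pi_ n.+1 = split_to (mesh (pi_ n)) 0 1 :> seq R.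
Proof.
have [s s0 E] := iter_refine_split_to n.
exact: (refine_split_to s0 E).
Qed.

(** [weighted_count_le] bounds the mesh [m] by a constant over
    [nb_split_to m], the number of intervals after one more refinement, and this
    number grows at each refinement. *)
Lemma mesh_iter_refine_le n : mesh (pi_ n) <= p^-1 / n.+1%:R.
Proof.
have m0 := mesh_gt0 (pi_ n).
have m1 : mesh (pi_ n) <= 1.
  have [J Jpi <-] := mesh_attained (pi_ n).
  by have [? ? ?] := itv_partition_in (pointsP (pi_ n)) Jpi; rewrite /width; lra.
rewrite ler_pdivlMr//.
have := weighted_count_le m0 ltac:(have := width_lb_lt1; nra).
apply: le_trans; rewrite ler_pM2l// ler_nat /nb_split_to.
rewrite -iter_refine_mesh; exact/ltnW/size_iter_refine.
Qed.

Lemma mesh_iter_refine_cvg : mesh (pi_ n) @[n --> \oo] --> (0 : R)^'+.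
Proof.
move=> A [r /= r0 rA].
have : p^-1 / n.+1%:R @[n --> \oo] --> (0 : R).
  by rewrite -(mulr0 p^-1); apply: cvgMr; exact: cvg_harmonic.
move=> /cvgrPdist_lt /(_ r r0) small.
suff : \forall n \near \oo, A (mesh (pi_ n)) by [].
near=> n; have m0 := mesh_gt0 (pi_ n).
apply: rA => //=; rewrite sub0r normrN (gtr0_norm m0).
apply: le_lt_trans (mesh_iter_refine_le n) _.
have : `|0 - p^-1 / n.+1%:R| < r by near: n.
by rewrite sub0r normrN ger0_norm// divr_ge0// invr_ge0 ltW.
Unshelve. all: by end_near. Qed.

Lemma iter_refine_uniformly_distributed :
  uniformly_distributed (fun n => pi_ n.+1).
Proof.
move=> f fc.
have := cvg_comp _ _ mesh_iter_refine_cvg (split_to_equidistributed fc).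
under [in X in _ -> X]eq_fun => n do rewrite /nb_intervals iter_refine_mesh.
by [].
Qed.

End Splitting.

Theorem theorem2p7 (R : realType) (rho : partition01 R) (hrho : nontrivial rho) :
  uniformly_distributed (fun n => iter n.+1 (refine rho) trivial_partition).
Proof.
have [p p0 rhop] := width_bounds hrho.
exact: iter_refine_uniformly_distributed p0 rhop hrho.
Qed.
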